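(* There exists $\alpha\in\mathbb{R}$ such that the discrepancy $D_N$ of the finite sequence $\{\alpha\, n!\}$, $1\le n\le N$, satisfies $D_N=O(\log N)$; that is, there is a constant $C>0$ (independent of $N$) such that $D_N\le C\log N$ for all integers $N\ge 2$.
   Context: $\{x\}$ denotes the fractional part of the real number $x$. For a sequence $\xi_1,\xi_2,\dots$ of points of $[0,1)$, the (unnormalized) discrepancy of its first $N$ points is $$D_N=\sup_{\gamma\in[0,1)}\bigl|N\gamma-\#\{j:\ 1\le j\le N,\ \xi_j\le\gamma\}\bigr|.$$ *)

(* Defs.v *)
From mathcomp Require Import all_boot all_order all_algebra.
From mathcomp Require Import all_classical all_reals all_analysis.
Set Implicit Arguments.
Unset Strict Implicit.
Unset Printing Implicit Defensive.
Import Order.TTheory GRing.Theory Num.Theory.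
Local Open Scope classical_set_scope.
Local Open Scope ring_scope.

Definition frac_part (R : realType) (x : R) : R := x - (Num.floor x)%:~R.

(* Sequences are indexed from 1: the value xi 0 is ignored. *)
Definition local_discrepancy (R : realType) (xi : nat -> R) (N : nat)
    (gamma : R) : R :=
  `|N%:R * gamma - (count (fun j => xi j <= gamma) (iota 1 N))%:R|.

Definition discrepancy (R : realType) (xi : nat -> R) (N : nat) : R :=
  sup [set local_discrepancy xi N gamma | gamma in `[0, 1[].

(* [sup] is a genuine supremum here, not its default value 0. *)
Lemma has_sup_discrepancy (R : realType) (xi : nat -> R) (N : nat) :
  has_sup [set local_discrepancy xi N gamma | gamma in `[0, 1[].
Proof.
split.
  by exists (local_discrepancy xi N 0), 0; rewrite //= in_itv /= lexx ltr01.
exists N%:R => _ [g /= + <-]; rewrite in_itv /= => /andP[g0 g1].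
have c_le : (count (fun j => xi j <= g) (iota 1 N))%:R <= N%:R :> R.
  by rewrite ler_nat (leq_trans (count_size _ _)) ?size_iota.
have Ng0 : 0 <= N%:R * g by rewrite mulr_ge0.
have Ng1 : N%:R * g <= N%:R by rewrite ler_piMr // ltW.
rewrite /local_discrepancy ler_norml lerBlDr -opprB lerN2.
rewrite (le_trans _ c_le) ?lerBlDr ?lerDl //=.
by rewrite (le_trans Ng1) // lerDl.
Qed.

(* Main.v *)
Require Import Defs.
From mathcomp Require Import all_boot all_order all_algebra.
From mathcomp Require Import all_classical all_reals all_analysis.
From mathcomp Require Import lra zify.
Import Order.TTheory GRing.Theory Num.Theory.
Local Open Scope ring_scope.

(** In a Cantor series [alpha = \sum_k a_k / k`!] with [0 <= a_k < k] the digit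
    [a_n.+1] determines the fractional part of [alpha * n`!] up to [1 / n.+1].
    Choosing the digits so that these fractional parts follow the van der Corput
    sequence costs an error [2 / n.+1], which is harmless: on an aligned block of
    [2 ^ k] consecutive indices [n >= 2 ^ k] the error is at most [2 / 2 ^ k], the
    scale of the equidistribution of van der Corput points on that block, so the
    block still has bounded discrepancy, and the integers from [1] to [N] split
    into [O(log N)] such blocks. *)

Lemma count_iota_double (P : pred nat) a n :
  count P (iota a.*2 n.*2) =
  (count (fun j => P j.*2) (iota a n) +
   count (fun j => P j.*2.+1) (iota a n))%N.
Proof.
elim: n a => [|n IH] a //=.
by rewrite -doubleS IH; lia.
Qed.

(** * Van der Corput points on dyadic blocks *)

Section VanDerCorput.
Variable R : realType.
Implicit Types (g : R) (a k m n r : nat).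

(* The [K] lowest binary digits of [n], mirrored at the binary point. *)
Fixpoint radical_inverse (K n : nat) : R :=
  if K is K'.+1 then (radical_inverse K' n./2 + (odd n)%:R) / 2 else 0.

Lemma radical_inverseS K n :
  radical_inverse K.+1 n = (radical_inverse K n./2 + (odd n)%:R) / 2.
Proof. by []. Qed.

(** [n] rounds suffice because [n] has at most [n] binary digits. *)
Definition van_der_corput n : R := radical_inverse n n.

Lemma radical_inverse_itv K n : 0 <= radical_inverse K n < 1.
Proof.
elim: K n => [|K IH] n /=; first by rewrite lexx ltr01.
by have /andP[] := IH n./2; case: (odd n) => /= h1 h2; apply/andP; split; lra.
Qed.

Lemma radical_inverse_stable K n :
  (n <= K)%N -> radical_inverse K n = van_der_corput n.
Proof.
have step L l : (l <= L)%N -> radical_inverse L.+1 l = radical_inverse L l.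
  elim: L l => [|L IH] l lL.
    have -> : l = 0%N by lia.
    by rewrite /= addr0 mul0r.
  by rewrite radical_inverseS IH //; lia.
elim: K => [|K IH] nK; first by have -> : n = 0%N by lia.
have [->//|nK'] := eqVneq n K.+1.
by rewrite step ?IH//; lia.
Qed.

Lemma van_der_corput_double n : van_der_corput n.*2 = van_der_corput n / 2.
Proof.
rewrite -(@radical_inverse_stable n.*2.+1) //= odd_double doubleK addr0.
by rewrite radical_inverse_stable //; lia.
Qed.

Lemma van_der_corput_doubleS n :
  van_der_corput n.*2.+1 = (van_der_corput n + 1) / 2.
Proof.
rewrite /van_der_corput /= odd_double /=.
by rewrite uphalf_double radical_inverse_stable //; lia.
Qed.

Lemma van_der_corput_itv n : 0 <= van_der_corput n < 1.
Proof. exact: radical_inverse_itv. Qed.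

(** Even indices give the points in [[0, 1/2)], odd indices those in [[1/2, 1)], each a half-scale
    copy of the sequence on the halved block. *)
Lemma count_van_der_corput_double g a n :
  count (fun j => van_der_corput j <= g)%R (iota a.*2 n.*2) =
  (count (fun j => van_der_corput j <= 2 * g)%R (iota a n) +
   count (fun j => van_der_corput j <= 2 * g - 1)%R (iota a n))%N.
Proof.
rewrite count_iota_double; congr addn; apply: eq_count => j.
  by rewrite van_der_corput_double; apply/idP/idP => ?; lra.
by rewrite van_der_corput_doubleS; apply/idP/idP => ?; lra.
Qed.

(** At each halving [g] cuts only one half of the unit interval; the other is empty or full and adds
    no error, so the constant 1 does not accumulate. Thresholds above 1 are allowed because [g] is
    later shifted upwards. *)
Lemma count_van_der_corput_le g k m : 0 <= g ->
  (count (fun j => van_der_corput j <= g) (iota (m * 2 ^ k) (2 ^ k)))%:R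
    <= 2 ^+ k * g + 1.
Proof.
elim: k g => [|k IH] g g0.
  by rewrite expr0 /=; case: (_ <= g) => /=; lra.
rewrite expnS mul2n -doubleMr count_van_der_corput_double natrD exprS.
have [g12|g12] := ltP g (1 / 2).
  rewrite [X in _ + X%:R](_ : _ = 0%N); last first.
    apply/eqP; rewrite -leqn0 leqNgt -has_count; apply/hasPn => j _.
    by rewrite -ltNge; have /andP[? _] := van_der_corput_itv j; lra.
  by have := IH (2 * g) ltac:(lra); lra.
have := IH (2 * g - 1) ltac:(lra).
have : (count (fun j => van_der_corput j <= 2 * g)
    (iota (m * 2 ^ k) (2 ^ k)))%:R <= 2 ^+ k :> R.
  by rewrite -natrX ler_nat (leq_trans (count_size _ _)) ?size_iota.
by lra.
Qed.

Lemma count_van_der_corput_ge g k m : g <= 1 ->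
  2 ^+ k * g - 1 <=
  (count (fun j => van_der_corput j <= g) (iota (m * 2 ^ k) (2 ^ k)))%:R.
Proof.
elim: k g => [|k IH] g g1.
  by rewrite expr0 /=; case: (_ <= g) => /=; lra.
rewrite expnS mul2n -doubleMr count_van_der_corput_double natrD exprS.
have [g12|g12] := ltP g (1 / 2).
  have := IH (2 * g) ltac:(lra).
  have := ler0n R (count (fun j => van_der_corput j <= 2 * g - 1)
    (iota (m * 2 ^ k) (2 ^ k))).
  by lra.
rewrite [X in X%:R + _](_ : _ = 2 ^ k)%N; last first.
  rewrite -[RHS](size_iota (m * 2 ^ k)); apply/eqP; rewrite -all_count.
  by apply/allP => j _; have /andP[_ ?] := van_der_corput_itv j; lra.
by have := IH (2 * g - 1) ltac:(lra); rewrite natrX; lra.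
Qed.

(** * Discrepancy of a perturbed van der Corput sequence *)

Section Perturbation.
Variable xi : nat -> R.
Hypothesis xi_near : forall n, (0 < n)%N ->
  `|xi n - van_der_corput n| <= 2 / n.+1%:R.

(** Kept signed, unlike [local_discrepancy], so as to be additive over consecutive blocks. *)
Definition block_error g a n : R :=
  n%:R * g - (count (fun j => xi j <= g) (iota a n))%:R.

Lemma block_errorD g a n r :
  block_error g a (n + r) = block_error g a n + block_error g (a + n) r.
Proof. by rewrite /block_error iotaD count_cat !natrD; lra. Qed.

Lemma block_error_dyadic g k m : (0 < m)%N -> 0 <= g <= 1 ->
  `|block_error g (m * 2 ^ k) (2 ^ k)| <= 3.
Proof.
move=> m0 /andP[g0 g1]; rewrite /block_error natrX.
(* As [0 < m], all indices in the block are at least [2 ^ k], so [e] bounds the perturbation there.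
   Shifting the threshold by [e] costs [2 ^ k * e = 2], which with the van der Corput error 1 makes
   3. *)
set B := iota _ _; pose e : R := 2 / 2 ^+ k.
have ek : 2 ^+ k * e = 2 by rewrite mulrC divfK // expf_neq0.
have e0 : 0 <= e by rewrite divr_ge0 ?exprn_ge0.
have near j : j \in B -> `|xi j - van_der_corput j| <= e.
  rewrite mem_iota => /andP[jB _].
  have kj : (2 ^ k <= j)%N by rewrite (leq_trans _ jB) // leq_pmull.
  have k0 : (0 < 2 ^ k)%N by rewrite expn_gt0.
  rewrite (le_trans (xi_near _ _)) ?(leq_trans k0)//.
  by rewrite ler_pM2l // lef_pV2 ?posrE ?exprn_gt0 // -natrX ler_nat leqW.
have upper : (count (fun j => xi j <= g)%R B <=
    count (fun j => van_der_corput j <= g + e)%R B)%N.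
  rewrite -!size_filter; apply: uniq_leq_size; first exact/filter_uniq/iota_uniq.
  move=> j; rewrite !mem_filter => /andP[xj jB]; rewrite jB andbT.
  by have := near j jB; rewrite ler_norml => /andP[? ?]; lra.
have lower : (count (fun j => van_der_corput j <= g - e)%R B <=
    count (fun j => xi j <= g)%R B)%N.
  rewrite -!size_filter; apply: uniq_leq_size; first exact/filter_uniq/iota_uniq.
  move=> j; rewrite !mem_filter => /andP[xj jB]; rewrite jB andbT.
  by have := near j jB; rewrite ler_norml => /andP[? ?]; lra.
have := count_van_der_corput_le (g + e) k m ltac:(lra).
have := count_van_der_corput_ge (g - e) k m ltac:(lra).
move: upper lower; rewrite -/B -!(ler_nat R) ler_norml => ? ? ? ?.
by apply/andP; split; lra.
Qed.

(** Halve the block: the segment either stays in the left half, or takes all of it at cost 3 and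
    continues into the right half. *)
Lemma block_error_initial g k m r : (0 < m)%N -> 0 <= g <= 1 ->
  (r <= 2 ^ k)%N -> `|block_error g (m * 2 ^ k) r| <= 3 * k.+1%:R.
Proof.
move=> + g01; elim: k m r => [|k IH] m r m0 rk.
  have [->|r0] := posnP r; first by rewrite /block_error mul0r subr0 normr0; lra.
  have -> : r = (2 ^ 0)%N by lia.
  by rewrite mulr1; exact: block_error_dyadic.
have mE : (m * 2 ^ k.+1 = m.*2 * 2 ^ k)%N by rewrite expnS; lia.
rewrite mE -(natr1 k.+1) mulrDr mulr1.
have [rk'|rk'] := leqP r (2 ^ k).
  by rewrite (le_trans (IH _ _ _ rk')) ?double_gt0 ?lerDl.
have -> : r = (2 ^ k + (r - 2 ^ k))%N by lia.
rewrite block_errorD [leRHS]addrC (le_trans (ler_normD _ _)) // lerD //.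
  by apply: block_error_dyadic; rewrite ?double_gt0.
have -> : (m.*2 * 2 ^ k + 2 ^ k = m.*2.+1 * 2 ^ k)%N by lia.
by apply: IH => //; move: rk; rewrite expnS; lia.
Qed.

(** The aligned blocks [[2 ^ i, 2 ^ i.+1)], [i < k], tile the indices from 1 to [2 ^ k - 1]. *)
Lemma block_error_pow2 g k : 0 <= g <= 1 ->
  `|block_error g 1 (2 ^ k).-1| <= 3 * k%:R.
Proof.
move=> g01; elim: k => [|k IH].
  by rewrite /block_error /= mul0r subr0 normr0 mulr0.
have k0 : (0 < 2 ^ k)%N by rewrite expn_gt0.
have -> : (2 ^ k.+1).-1 = ((2 ^ k).-1 + 2 ^ k)%N by rewrite expnS; lia.
rewrite block_errorD add1n prednK // -(natr1 k) mulrDr mulr1.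
rewrite (le_trans (ler_normD _ _)) // lerD //.
by rewrite -[X in block_error g X _]mul1n; exact: block_error_dyadic.
Qed.

Lemma discrepancy_near_van_der_corput N : (2 <= N)%N ->
  discrepancy xi N <= 9 / ln 2 * ln N%:R.
Proof.
move=> N2; apply: ge_sup.
  by have [] := has_sup_discrepancy xi N.
move=> _ [g /= + <-]; rewrite in_itv /= => /andP[g0 /ltW g1].
have g01 : 0 <= g <= 1 by rewrite g0.
pose k := trunc_log 2 N.
have /andP[kN Nk] : (2 ^ k <= N < 2 ^ k.+1)%N by apply: trunc_log_bounds; lia.
have k0 : (0 < k)%N by rewrite trunc_log_gt0.
have k20 : (0 < 2 ^ k)%N by rewrite expn_gt0.
rewrite /local_discrepancy -/(block_error g 1 N).
have -> : N = ((2 ^ k).-1 + (N - (2 ^ k).-1))%N by lia.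
rewrite block_errorD add1n prednK // (le_trans (ler_normD _ _)) //.
have h1 := @block_error_pow2 g k g01.
have h2 : `|block_error g (2 ^ k) (N - (2 ^ k).-1)| <= 3 * k.+1%:R.
  rewrite -[X in block_error g X _]mul1n; apply: block_error_initial => //.
  by move: Nk; rewrite expnS; lia.
have -> : ((2 ^ k).-1 + (N - (2 ^ k).-1))%N = N by lia.
have ln20 : 0 < ln 2 :> R by rewrite ln_gt0 // ltr1n.
have h3 : k%:R * ln 2 <= ln N%:R :> R.
  rewrite mulrC mulr_natr -lnXn // -natrX ler_ln ?posrE ?ltr0n ?ler_nat //.
  by lia.
have h4 : 9 * k%:R <= 9 / ln 2 * ln N%:R :> R.
  by rewrite -mulrA ler_pM2l // mulrC ler_pdivlMr.
(* The two pieces cost [3 * k + 3 * k.+1], at most [9 * k] once [1 <= k]. *)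
have h5 : 1 <= k%:R :> R by rewrite ler1n.
by move: h2; rewrite -natr1; lra.
Qed.

End Perturbation.
End VanDerCorput.

(** * Cantor series with prescribed fractional parts *)

Section CantorSeries.
Variable R : realType.
Variable y : nat -> R.
Hypothesis y_itv : forall n, 0 <= y n < 1.

(* The digit [a_n.+1] is [floor (n * y n)] rather than [floor (n.+1 * y n)], so
   that it never takes its largest value [n] and the expansion is proper. *)
Fixpoint cantor_numerator n : nat :=
  if n is n'.+1
  then (n'.+1 * cantor_numerator n' + Num.truncn (n'%:R * y n'))%N
  else 0%N.

(** [lo n] is the partial sum of the series up to [k = n]; the intervals from [lo n] to [hi n] are
    nested and enclose the full sum. *)
Let lo n : R := (cantor_numerator n)%:R / n`!%:R.
Let hi n : R := (cantor_numerator n).+1%:R / n`!%:R.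

Let fact_pos n : 0 < n`!%:R :> R.
Proof. by rewrite ltr0n fact_gt0. Qed.

Let digit_itv n :
  (Num.truncn (n%:R * y n))%:R <= n%:R * y n
    < (Num.truncn (n%:R * y n)).+1%:R.
Proof.
by apply: truncn_itv; rewrite mulr_ge0 //; case/andP: (y_itv n).
Qed.

Let lo_step n : lo n <= lo n.+1.
Proof.
rewrite /lo factS natrM ler_pdivlMr ?mulr_gt0 // mulrCA divfK ?gt_eqF //=.
by rewrite -natrM ler_nat leq_addr.
Qed.

Let hi_step n : (0 < n)%N -> hi n.+1 < hi n.
Proof.
move=> n0; rewrite /hi factS natrM ltr_pdivrMr ?mulr_gt0 // mulrCA.
rewrite divfK ?gt_eqF // -natrM ltr_nat /=.
suff : (Num.truncn (n%:R * y n) < n)%N by lia.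
rewrite -(ltr_nat R); have /andP[/le_lt_trans-> //] := digit_itv n.
by rewrite gtr_pMr ?ltr0n //; case/andP: (y_itv n).
Qed.

Let lo_hi n : lo n <= hi n.
Proof. by rewrite /lo /hi ler_pM2r ?invr_gt0 // ler_nat. Qed.

Let lo_le m n : (m <= n)%N -> lo m <= lo n.
Proof. by apply: (homo_leq (r := <=%O)) => //; exact: le_trans. Qed.

Let hi_le m n : (0 < m)%N -> (m <= n)%N -> hi n <= hi m.
Proof.
move=> m0; elim: n => [|n IH] mn; first by lia.
have [<-//|mn'] := eqVneq m n.+1.
by rewrite (le_trans (ltW (hi_step n _))) ?IH //; lia.
Qed.

Let lo_le_hi m n : (0 < n)%N -> lo m <= hi n.
Proof.
move=> n0; have [mn|/ltnW nm] := leqP m n.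
  exact: le_trans (lo_le _ _ mn) (lo_hi n).
exact: le_trans (lo_hi m) (hi_le _ _ n0 nm).
Qed.

Definition cantor_sum : R := sup (range lo).

Let cantor_sum_itv n : (0 < n)%N -> lo n <= cantor_sum < hi n.
Proof.
move=> n0; apply/andP; split.
  apply: ub_le_sup; last by exists n.
  by exists (hi 1) => _ [m _ <-]; exact: lo_le_hi.
(* A supremum inherits only the weak bound; going through [hi n.+1] makes it strict, as the floor
   computation requires. *)
apply: le_lt_trans (hi_step n n0); apply: ge_sup; first by exists (lo 0), 0%N.
by move=> _ [m _ <-]; exact: lo_le_hi.
Qed.

Let cantor_frac_itv n : (0 < n)%N ->
  (cantor_numerator n)%:R <= cantor_sum * n`!%:R < (cantor_numerator n).+1%:R.
Proof.
by move=> /cantor_sum_itv; rewrite /lo /hi ler_pdivrMr // ltr_pdivlMr.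
Qed.

Let frac_cantor_sum n : (0 < n)%N ->
  frac_part (cantor_sum * n`!%:R) = cantor_sum * n`!%:R - (cantor_numerator n)%:R.
Proof.
move=> n0; rewrite /frac_part (@floor_def _ _ (cantor_numerator n)%:Z) //.
by rewrite intrD -!pmulrn natr1 cantor_frac_itv.
Qed.

(** With [d] the digit, both [n.+1] times the fractional part and [n * y n] lie in [[d, d + 1)];
    replacing [n * y n] by [n.+1 * y n] costs [y n < 1] more, whence the 2. *)
Lemma frac_cantor_sum_near n : (0 < n)%N ->
  `|frac_part (cantor_sum * n`!%:R) - y n| <= 2 / n.+1%:R.
Proof.
move=> n0; rewrite frac_cantor_sum //.
have /andP[] := cantor_frac_itv n.+1 isT.
have /andP[] := digit_itv n; have /andP[] := y_itv n.
rewrite /= factS natrM -addnS !natrD natrM.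
set d := Num.truncn _; set c := cantor_numerator n.
rewrite -!natr1.
have n1 : 0 < n%:R + 1 :> R by rewrite ltr_wpDl.
rewrite ler_pdivlMr // -[X in _ * X <= _]gtr0_norm // -normrM.
rewrite ler_norml => y0 y1 d1 d2 h1 h2.
by apply/andP; split; lra.
Qed.

End CantorSeries.

Theorem mainTheorem2 (R : realType) :
  exists (alpha : R) (C : R), 0 < C /\
    forall N : nat, (2 <= N)%N ->
      discrepancy (fun n : nat => frac_part (alpha * (n`!)%:R)) N <= C * ln (N%:R).
Proof.
exists (cantor_sum R (van_der_corput R)), (9 / ln 2); split.
  by rewrite divr_gt0 // ln_gt0 // ltr1n.
move=> N N2; apply: discrepancy_near_van_der_corput => // n n0.
by apply: frac_cantor_sum_near => // m; exact: van_der_corput_itv.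
Qed.
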